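(* Let $d\in\mathbb{N}$ and let $F\in GL_d(\mathbb{C})$ be a generic matrix (i.e. the eigenvalues of $F^*F$ are pairwise distinct) such that $F\bar F=\pm I$. Then the universal orthogonal quantum group $O_F^+$ (i.e. the augmented algebra $(\mathrm{Pol}(O_F^+),\epsilon)$) has property (GC), hence also property (LK).
   Context: For a matrix $a=(a_{jk})$ over a $^*$-algebra, $a^t=(a_{kj})$, $\bar a=(a_{jk}^* )$, $a^*=\bar a^t$; for $F\in M_d(\mathbb{C})$, $\bar F$ is the entrywise complex conjugate. $\mathrm{Pol}(O_F^+)$ is the universal unital $^*$-algebra generated by $v_{jk}$, $1\le j,k\le d$, subject to the relations that $v=(v_{jk})$ is unitary and $v=F\bar vF^{-1}$. Its character (counit) $\epsilon$ is the unital $^*$-homomorphism to $\mathbb{C}$ with $\epsilon(v_{jk})=\delta_{jk}$. Let $A$ be a unital $^*$-algebra with a character $\epsilon$, generated as a $^*$-algebra by the entries of a unitary matrix. Inner products are linear in the second argument; a representation on a Hilbert space $H$ means a unital $^*$-representation $\rho:A\to B(H)$. A $\rho$-$\epsilon$-cocycle is a linear map $\eta:A\to H$ with $\eta(ab)=\rho(a)\eta(b)+\eta(a)\epsilon(b)$. A Schürmann triple is $(\rho,\eta,\psi)$ with $\rho$ a representation, $\eta$ a $\rho$-$\epsilon$-cocycle and $\psi:A\to\mathbb{C}$ linear with $\psi(ab)=\psi(a)\epsilon(b)+\epsilon(a)\psi(b)+\langle\eta(a^* ),\eta(b)\rangle$ for all $a,b\in A$. A cocycle $\eta$ is Gaussian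 if $\rho=\epsilon(\cdot)\,\mathrm{id}_H$, i.e. $\eta(ab)=\epsilon(a)\eta(b)+\eta(a)\epsilon(b)$. A generating functional is a linear $\psi:A\to\mathbb{C}$ with $\psi(1)=0$, $\psi(a^* )=\overline{\psi(a)}$ and $\psi(a^*a)\ge0$ for $a\in\ker\epsilon$. Every generating functional $\psi$ is part of a Schürmann triple $(\rho,\eta,\psi)$ with $\eta(A)$ dense in $H$, unique up to unitary equivalence (the associated triple). Put $H_G=\{\xi\in H:\rho(a)\xi=\epsilon(a)\xi\ \forall a\in A\}$, $P_G$ the orthogonal projection onto $H_G$, $\rho_G=\rho|_{H_G}$, $\rho_N=\rho|_{H_G^\perp}$, $\eta_G=P_G\eta$, $\eta_N=(I-P_G)\eta$. One says $\psi$ admits a Lévy–Khintchine decomposition if there exist generating functionals $\psi_G,\psi_N$ such that $(\rho_G,\eta_G,\psi_G)$ and $(\rho_N,\eta_N,\psi_N)$ are Schürmann triples. Property (LK): every generating functional on $(A,\epsilon)$ admits a Lévy–Khintchine decomposition. Property (GC): every Gaussian cocycle $\eta:A\to H$ (any Hilbert space $H$) can be completed to a Schürmann triple $(\epsilon(\cdot)\mathrm{id},\eta,\psi)$. *)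

(* Defs.v *)
From HB Require Import structures.
From mathcomp Require Import all_boot all_order all_algebra.
From mathcomp Require Import generic_quotient complex.
From mathcomp Require Import boolp classical_sets reals topology normedtype.

Set Implicit Arguments.
Unset Strict Implicit.
Unset Printing Implicit Defensive.

Import Order.TTheory GRing.Theory Num.Theory.
Import numFieldNormedType.Exports.

Local Open Scope classical_set_scope.
Local Open Scope complex_scope.
Local Open Scope ring_scope.

HB.mixin Record hasStar (R : realType) A of GRing.Algebra R[i] A := {
  star : A -> A;
  starK : involutive star;
  starD : forall a b, star (a + b) = star a + star b;
  starM : forall a b, star (a * b) = star b * star a;
  starZ : forall (c : R[i]) a, star (c *: a) = c^* *: star a
}.

#[short(type="starAlgType")]
HB.structure Definition StarAlgebra (R : realType) :=
  {A of GRing.Algebra R[i] A & hasStar R A}.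

(* [inner] is linear in its second argument. *)
HB.mixin Record hasInner (R : realType) H of CompleteNormedModule R[i] H := {
  inner : H -> H -> R[i];
  inner_linear : forall x, scalar (inner x);
  innerC : forall x y, inner y x = (inner x y)^*;
  inner_norm : forall x, inner x x = `|x| ^+ 2
}.

#[short(type="hilbertType")]
HB.structure Definition Hilbert (R : realType) :=
  {H of CompleteNormedModule R[i] H & hasInner R H}.

Section CauchySchwarz.
Context {R : realType} {H : hilbertType R}.
Implicit Types x y z : H.

Lemma innerDr x y z : inner x (y + z) = inner x y + inner x z.
Proof. by have := inner_linear x 1 y z; rewrite scale1r mul1r. Qed.

Lemma inner0r x : inner x 0 = 0 :> R[i].
Proof. by apply: (addrI (inner x 0)); rewrite -innerDr !addr0. Qed.

Lemma innerZr (c : R[i]) x y : inner x (c *: y) = c * inner x y.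
Proof. by have := inner_linear x c y 0; rewrite inner0r !addr0. Qed.

Lemma innerNr x y : inner x (- y) = - inner x y.
Proof. by rewrite -scaleN1r innerZr mulN1r. Qed.

Lemma innerBr x y z : inner x (y - z) = inner x y - inner x z.
Proof. by rewrite innerDr innerNr. Qed.

Lemma innerDl x y z : inner (x + y) z = inner x z + inner y z.
Proof. by rewrite innerC innerDr rmorphD /= -!innerC. Qed.

Lemma innerZl (c : R[i]) x y : inner (c *: x) y = c^* * inner x y.
Proof. by rewrite innerC innerZr rmorphM /= -innerC. Qed.

Lemma innerNl x y : inner (- x) y = - inner x y.
Proof. by rewrite innerC innerNr rmorphN /= -innerC. Qed.

Lemma innerBl x y z : inner (x - y) z = inner x z - inner y z.
Proof. by rewrite innerDl innerNl. Qed.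

Lemma cauchy_schwarz x y : `|inner x y| <= `|x| * `|y|.
Proof.
have [->|x0] := eqVneq x 0.
  rewrite normr0 mul0r -(scale0r (0 : H)) innerZl.
  by rewrite rmorph0 mul0r normr0.
have nx : 0 < `|x| by rewrite normr_gt0.
pose c := inner x y / `|x| ^+ 2.
have h : 0 <= inner (y - c *: x) (y - c *: x) by rewrite inner_norm exprn_ge0.
have cE : inner x (y - c *: x) = 0.
  by rewrite innerBr innerZr inner_norm /c divfK ?subrr// expf_neq0// gt_eqF.
rewrite innerBl innerZl cE mulr0 subr0 innerBr innerZr subr_ge0 in h.
rewrite -(ler_pXn2r (n := 2))// ?nnegrE ?mulr_ge0//.
rewrite exprMn normCK -(innerC x y).
rewrite -ler_pdivrMl ?exprn_gt0//; rewrite inner_norm in h.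
by apply: le_trans h; rewrite /c mulrCA mulrA.
Qed.

End CauchySchwarz.

Section ClosedSubspace.
Context (R : realType) (H : hilbertType R).

Record closed_subspace := ClosedSubspace {
  subspace_set :> set H;
  subspace_closed : closed subspace_set;
  subspace0 : subspace_set 0;
  subspaceP : forall (c : R[i]) x y,
    subspace_set x -> subspace_set y -> subspace_set (c *: x + y)
}.

Lemma closed_zeros (W : normedZmodType R[i]) (g : H -> W) (M : R[i]) :
  (forall x y, `|g x - g y| <= M * `|x - y|) -> closed [set x | g x = 0].
Proof.
move=> gM x clx; apply/eqP; rewrite -normr_le0.
have M0 : 0 < `|M| + 1 by rewrite ltr_wpDl.
apply/ler_addgt0Pr => e e0; rewrite add0r.
have [|y /= [gy0]] := clx (ball x (e / (`|M| + 1))).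
  by apply: nbhsx_ballx; rewrite divr_gt0.
rewrite -ball_normE /= => /ltW xy.
have := gM x y; rewrite gy0 subr0 => gx.
have : `|g x| <= `|M| * `|x - y|.
  by rewrite -[`|x - y|]normr_id -normrM ger0_norm// (le_trans _ gx).
move=> /le_trans; apply; rewrite (@le_trans _ _ ((`|M| + 1) * `|x - y|))//.
  by rewrite ler_wpM2r// lerDl.
by rewrite mulrC -ler_pdivlMr.
Qed.

Definition orthogonal (S : set H) : set H :=
  [set y | forall x, S x -> inner x y = 0].

Lemma orthogonal_closed S : closed (orthogonal S).
Proof.
rewrite (_ : orthogonal S = \bigcap_(x in S) [set y | inner x y = 0]).
  apply: closed_bigI => x _; apply: (@closed_zeros _ _ `|x|) => y z.
  by rewrite -innerBr cauchy_schwarz.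
by [].
Qed.

Lemma orthogonal_0 S : orthogonal S 0.
Proof. by move=> x _; rewrite inner0r. Qed.

Lemma orthogonal_P S (c : R[i]) x y :
  orthogonal S x -> orthogonal S y -> orthogonal S (c *: x + y).
Proof.
by move=> Sx Sy z Sz; rewrite innerDr innerZr Sx// Sy// mulr0 addr0.
Qed.

Definition orthocomplement (S : set H) : closed_subspace :=
  ClosedSubspace (@orthogonal_closed S) (@orthogonal_0 S) (@orthogonal_P S).

(* A closed subspace seen as a Hilbert space of its own (instances below). *)
Definition carrier (S : closed_subspace) : Type :=
  {x : H | x \in (S : set H)}.

End ClosedSubspace.

Section SubHilbert.
Context (R : realType) (H : hilbertType R) (S : closed_subspace H).
Local Notation T := (carrier S).
Local Notation inS := (fun x : H => x \in (S : set H)).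

Lemma subspace_submod : subsemimod_closed inS.
Proof.
split; first split.
- exact/mem_set/subspace0.
- move=> x y /set_mem xS /set_mem yS; apply/mem_set.
  by rewrite -[x]scale1r; exact: subspaceP.
- move=> c x /set_mem xS; apply/mem_set.
  by rewrite -[_ *: _]addr0; apply: subspaceP => //; exact: subspace0.
Qed.

HB.instance Definition _ := SubChoice.copy T {x : H | x \in (S : set H)}.
HB.instance Definition _ :=
  GRing.SubChoice_isSubLmodule.Build R[i] H inS T subspace_submod.

Let norm (x : T) : R[i] := `|val x|.

Let ler_normD x y : norm (x + y) <= norm x + norm y.
Proof. by rewrite /norm raddfD ler_normD. Qed.

Let normrZ (l : R[i]) x : norm (l *: x) = `|l| * norm x.
Proof. by rewrite /norm linearZ /= normrZ. Qed.

Let normr0_eq0 x : norm x = 0 -> x = 0.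
Proof. by move=> /normr0_eq0 x0; apply: val_inj; rewrite raddf0. Qed.

HB.instance Definition _ :=
  Lmodule_isNormed.Build R[i] T ler_normD normrZ normr0_eq0.

Lemma carrier_normE (x : T) : `|x| = `|val x|.
Proof. by []. Qed.

Lemma carrier_complete (F : set_system T) :
  ProperFilter F -> cauchy F -> cvg F.
Proof.
move=> FF /cauchyP Fc.
have vc : cauchy (val @ F : set_system H).
  by apply: cauchy_exP => e /Fc[x Fx]; exists (val x); move: Fx;
     rewrite /= -!ball_normE.
set l := lim (val @ F : set_system H).
have Fl : val @ F --> l by exact: (cauchy_cvg _ vc).
have Sl : (S : set H) l.
  apply: (@closed_cvg _ _ F _ val (S : set H) (@subspace_closed _ _ S) _ l Fl).
  by apply: nearW => x; exact: set_mem (valP x).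
apply: (cvgP (exist _ l (mem_set Sl) : T)); apply/cvg_ballP => e e0.
have /cvg_ballP /(_ e e0) := Fl; apply: filterS => x.
by rewrite -!ball_normE.
Qed.

HB.instance Definition _ := Uniform_isComplete.Build T carrier_complete.

Let sub_inner (x y : T) : R[i] := inner (val x) (val y).

Let sub_inner_linear x : scalar (sub_inner x).
Proof. by move=> c y z; rewrite /sub_inner linearP /= innerDr innerZr. Qed.

Let sub_innerC x y : sub_inner y x = (sub_inner x y)^*.
Proof. exact: innerC. Qed.

Let sub_inner_norm x : sub_inner x x = `|x| ^+ 2.
Proof. exact: inner_norm. Qed.

HB.instance Definition _ :=
  hasInner.Build R T sub_inner_linear sub_innerC sub_inner_norm.

End SubHilbert.

Section Projection.
Context (R : realType) (H : hilbertType R) (S : closed_subspace H).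
Local Notation inS := (S : set H).

Lemma almost_orthogonal (x y s : H) (d e : R[i]) : 0 <= e ->
  (forall z, inS z -> d <= `|x - z| ^+ 2) ->
  inS y -> inS s -> `|x - y| ^+ 2 <= d + e ^+ 2 ->
  `|inner s (x - y)| <= e * `|s|.
Proof.
move=> e0 dmin Sy Ss ye.
have [->|s0] := eqVneq s 0.
  rewrite normr0 mulr0 -(scale0r (0 : H)) innerZl.
  by rewrite rmorph0 mul0r normr0.
have ns : 0 < `|s| by rewrite normr_gt0.
pose c := inner s (x - y) / `|s| ^+ 2.
have := dmin (c *: s + y) (subspaceP c Ss Sy).
have cE : inner s (x - y - c *: s) = 0.
  rewrite [LHS]innerBr innerZr inner_norm /c divfK ?subrr//.
  by rewrite expf_neq0// gt_eqF.
rewrite opprD addrCA addrC -inner_norm.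
rewrite [X in _ <= X -> _]innerBl innerZl cE mulr0 subr0.
rewrite (innerBr (x - y) (x - y)) innerZr inner_norm.
rewrite lerBrDr => /le_trans/(_ ye); rewrite lerD2l.
rewrite innerC /c mulrAC -normCK ler_pdivrMr ?exprn_gt0// -exprMn.
by rewrite ler_pXn2r ?nnegrE ?mulr_ge0.
Qed.

Lemma projection_exists (x : H) :
  exists y : carrier S, orthogonal S (x - val y).
Proof.
pose q (y : H) : R := complex.Re (`|x - y| ^+ 2).
have qE y : (q y)%:C = `|x - y| ^+ 2 by rewrite RRe_real// ger0_real// exprn_ge0.
have q0 y : 0 <= q y by rewrite -lecR qE exprn_ge0.
pose Q := [set q y | y in inS].
have lbQ : has_lbound Q by exists 0 => _ [y _ <-].
have infQ : has_inf Q.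
  by split=> //; exists (q 0), 0 => //; exact: subspace0.
pose d := (inf Q)%:C.
have dmin z : inS z -> d <= `|x - z| ^+ 2.
  by move=> Sz; rewrite -qE lecR; apply: ge_inf => //; exists z.
pose B (e : R) := [set y | inS y /\ `|x - y| ^+ 2 <= d + e%:C ^+ 2].
have B0 e : 0 < e -> B e !=set0.
  move=> e0; have [_ [y Sy <-] ye] := inf_adherent (exprn_gt0 2 e0) infQ.
  exists y; split=> //; rewrite -qE.
  by rewrite -rmorphXn -rmorphD /= lecR ltW.
have Borth e y s : 0 < e -> B e y -> inS s -> `|inner s (x - y)| <= e%:C * `|s|.
  move=> e0 [Sy ye] Ss; apply: (almost_orthogonal _ dmin) => //.
  by rewrite lecR ltW.
have Bdist e y z : 0 < e -> B e y -> B e z -> `|y - z| <= e%:C + e%:C.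
  move=> e0 By Bz; set s := y - z.
  have Ss : inS s.
    rewrite /s addrC -scaleN1r; apply: subspaceP; [exact: Bz.1|exact: By.1].
  have [->|s0] := eqVneq s 0; first by rewrite normr0 addr_ge0// lecR ltW.
  have ns : 0 < `|s| by rewrite normr_gt0.
  rewrite -(ler_pM2r ns) -expr2 mulrDl.
  rewrite -[leLHS]ger0_norm ?exprn_ge0// -inner_norm.
  have -> : inner s s = inner s (x - z) - inner s (x - y).
    rewrite -innerBr; congr inner.
    by rewrite opprB addrC addrA subrK.
  by rewrite (le_trans (ler_normB _ _))// lerD// Borth.
pose F := filter_from [set e : R | 0 < e] B.
have FF : ProperFilter F.
  apply: filter_from_proper => //; apply: filter_from_filter.
    by exists 1; rewrite /= ltr01.
  move=> i j /= i0 j0; exists (Num.min i j); first by rewrite /= lt_min i0.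
  move=> y [Sy ye]; split; split=> //; apply: (le_trans ye);
    rewrite lerD2l -!rmorphXn lecR /= lerXn2r//
      ?nnegrE ?ge_min ?lexx ?orbT ?le_min ?(ltW i0) ?(ltW j0)//.
have Fc : cauchy (F : set_system H).
  apply: cauchy_exP => e e0.
  pose r := complex.Re e.
  have rE : r%:C = e by rewrite RRe_real// gtr0_real.
  have r0 : 0 < r by rewrite -ltcR rE.
  have r30 : 0 < r / 3 by rewrite divr_gt0.
  have [y By] := B0 _ r30; exists y, (r / 3) => // z Bz.
  rewrite -ball_normE /=; apply: (le_lt_trans (Bdist _ _ _ r30 By Bz)).
  rewrite -rmorphD /= -rE ltcR -mulrDr -[ltRHS]mulr1 ltr_pM2l//.
  by rewrite -mulr2n -[_ *+ 2]mulr_natl ltr_pdivrMr// mul1r ltr_nat.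
pose p : H := lim F.
have Fp : F --> p by exact: (cauchy_cvg _ Fc).
have Sp : inS p.
  apply: (@closed_cvg _ _ F _ id inS (@subspace_closed _ _ S) _ p Fp).
  by exists 1; [rewrite /= ltr01|move=> y []].
exists (exist _ p (mem_set Sp)) => s Ss /=.
apply/eqP; rewrite -normr_le0; apply/ler_addgt0Pr => e e0; rewrite add0r.
pose r := complex.Re e.
have rE : r%:C = e by rewrite RRe_real// gtr0_real.
have r0 : 0 < r by rewrite -ltcR rE.
pose m := complex.Re `|s|.
have mE : m%:C = `|s| by rewrite RRe_real// normr_real.
have m0 : 0 <= m by rewrite -lecR mE normr_ge0.
pose t := r / (2 * (m + 1)).
have t0 : 0 < t by rewrite divr_gt0// mulr_gt0// ltr_wpDl.
have tC0 : 0 < t%:C by rewrite ltcR.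
have Bt : F (B t) by exists t.
have Fb : F (ball p t%:C) by apply: (Fp (ball p t%:C)); exact: nbhsx_ballx.
have [y [By py]] := filter_ex (filterI Bt Fb).
move: py; rewrite -ball_normE /= => /ltW py.
have -> : x - p = (x - y) - (p - y) by rewrite opprB addrA subrK.
rewrite innerBr (le_trans (ler_normB _ _))//.
rewrite (@le_trans _ _ (t%:C * `|s| + `|s| * t%:C))//.
  rewrite lerD ?Borth// (le_trans (cauchy_schwarz _ _))//.
  by rewrite ler_wpM2l.
rewrite -mE -rE -!rmorphM -rmorphD /= lecR /t.
rewrite (mulrC m) -mulr2n -[leRHS]mulr1 -mulrnAr -mulrA ler_pM2l//.
rewrite ler_pdivrMl ?mulr_gt0 ?ltr_wpDl// mulr1 -mulr_natl.
by rewrite ler_pM2l// lerDl.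
Qed.

End Projection.

Section OrthogonalProjection.
Context (R : realType) (H : hilbertType R) (S : closed_subspace H).

Definition proj (x : H) : carrier S := projT1 (cid (projection_exists S x)).

Lemma proj_orthogonal (x : H) : orthogonal S (x - val (proj x)).
Proof. exact: (projT2 (cid (projection_exists S x))). Qed.

(* [coproj] is I - P, corestricted to the orthogonal complement. *)
Definition coproj (x : H) : carrier (orthocomplement S) :=
  exist _ (x - val (proj x)) (mem_set (@proj_orthogonal x)).

End OrthogonalProjection.

Section Representations.
Context (R : realType) (A : starAlgType R).

Record character := Character {
  character_fun :> {lrmorphism A -> R[i] | *%R};
  character_star : forall a, character_fun (star a) = (character_fun a)^*
}.

Record representation (H : hilbertType R) := Representation {
  rep_fun :> A -> H -> H;
  rep_op_linear : forall a, linear (rep_fun a);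
  rep_op_bounded : forall a,
    exists M : R[i], forall x, `|rep_fun a x| <= M * `|x|;
  rep_linear : forall x, linear (rep_fun^~ x);
  rep1 : forall x, rep_fun 1 x = x;
  repM : forall a b x, rep_fun (a * b) x = rep_fun a (rep_fun b x);
  rep_star : forall a x y, inner (rep_fun a x) y = inner x (rep_fun (star a) y)
}.

Section Trivial.
Context (eps : character) (H : hilbertType R).
Let rho (a : A) (x : H) := eps a *: x.

Let op_linear a : linear (rho a).
Proof. by move=> c x y; rewrite /rho scalerDr !scalerA mulrC. Qed.

Let op_bounded a : exists M : R[i], forall x, `|rho a x| <= M * `|x|.
Proof. by exists `|eps a| => x; rewrite normrZ. Qed.

Let linear_l x : linear (rho^~ x).
Proof. by move=> c a b; rewrite /rho linearP /= scalerDl scalerA. Qed.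

Let rho1 x : rho 1 x = x.
Proof. by rewrite /rho rmorph1 scale1r. Qed.

Let rhoM a b x : rho (a * b) x = rho a (rho b x).
Proof. by rewrite /rho rmorphM scalerA. Qed.

Let rho_star a x y : inner (rho a x) y = inner x (rho (star a) y).
Proof. by rewrite /rho innerZl innerZr character_star. Qed.

Definition trivial_rep : representation H :=
  Representation op_linear op_bounded linear_l rho1 rhoM rho_star.

End Trivial.

Section Restriction.
Context (H : hilbertType R) (rho : representation H) (S : closed_subspace H).
Context (rhoS : forall a x, (S : set H) x -> (S : set H) (rho a x)).

Let rhoS' (a : A) (x : carrier S) : carrier S :=
  exist _ (rho a (val x)) (mem_set (rhoS a (set_mem (valP x)))).

Let op_linear a : linear (rhoS' a).
Proof. by move=> c x y; apply: val_inj; rewrite !linearP /= rep_op_linear. Qed.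

Let op_bounded a : exists M : R[i], forall x, `|rhoS' a x| <= M * `|x|.
Proof.
by have [M hM] := rep_op_bounded rho a; exists M => x; exact: hM.
Qed.

Let linear_l x : linear (rhoS'^~ x).
Proof. by move=> c a b; apply: val_inj; rewrite !linearP /= rep_linear. Qed.

Let rho1 x : rhoS' 1 x = x.
Proof. by apply: val_inj; rewrite /= rep1. Qed.

Let rhoM a b x : rhoS' (a * b) x = rhoS' a (rhoS' b x).
Proof. by apply: val_inj; rewrite /= repM. Qed.

Let rho_star a x y : inner (rhoS' a x) y = inner x (rhoS' (star a) y).
Proof. exact: (rep_star rho). Qed.

Definition restriction : representation (carrier S) :=
  Representation op_linear op_bounded linear_l rho1 rhoM rho_star.

End Restriction.

Section GaussianPart.
Context (eps : character) (H : hilbertType R) (rho : representation H).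

Definition gaussian_set : set H := [set x | forall a, rho a x = eps a *: x].

Lemma gaussian_set_closed : closed gaussian_set.
Proof.
rewrite (_ : gaussian_set =
    \bigcap_(a in setT) [set x | rho a x - eps a *: x = 0]).
  apply: closed_bigI => a _; have [M hM] := rep_op_bounded rho a.
  apply: (@closed_zeros _ _ _ _ (M + `|eps a|)) => x y.
  rewrite opprD addrACA -[- (eps a *: x) - _]opprD -scalerBr.
  have -> : rho a x - rho a y = rho a (x - y).
    by rewrite -(scaleN1r y) [in RHS]addrC rep_op_linear scaleN1r addrC.
  by rewrite (le_trans (ler_normB _ _))// normrZ mulrDl lerD2r.
apply/seteqP; split=> x /= h a.
  by move=> _ /=; rewrite (h a) subrr.
by apply/eqP; rewrite -subr_eq0; apply/eqP; exact: (h a I).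
Qed.

Lemma gaussian_set0 : gaussian_set 0.
Proof.
move=> a; have := rep_op_linear rho a (-1) 0 0.
by rewrite !scaleN1r oppr0 addr0 addNr scaler0.
Qed.

Lemma gaussian_setP (c : R[i]) x y :
  gaussian_set x -> gaussian_set y -> gaussian_set (c *: x + y).
Proof.
by move=> gx gy a; rewrite rep_op_linear gx gy scalerDr !scalerA mulrC.
Qed.

Definition gaussian_space : closed_subspace H :=
  ClosedSubspace gaussian_set_closed gaussian_set0 gaussian_setP.

Lemma gaussian_space_stable a x :
  (gaussian_space : set H) x -> (gaussian_space : set H) (rho a x).
Proof. by move=> gx b; rewrite -!repM gx /= gx rmorphM scalerA. Qed.

Lemma gaussian_compl_stable a x :
  (orthocomplement gaussian_space : set H) x ->
  (orthocomplement gaussian_space : set H) (rho a x).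
Proof.
move=> ox y gy; rewrite -[a]starK -rep_star gy.
by rewrite innerZl ox// mulr0.
Qed.

Definition rho_G : representation (carrier gaussian_space) :=
  restriction gaussian_space_stable.

Definition rho_N : representation (carrier (orthocomplement gaussian_space)) :=
  restriction gaussian_compl_stable.

End GaussianPart.

Section Schurmann.
Context (eps : character).

Definition is_cocycle (H : hilbertType R) (rho : representation H)
    (eta : A -> H) : Prop :=
  linear eta /\
  forall a b, eta (a * b) = rho a (eta b) + eps b *: eta a.

Definition is_schurmann_triple (H : hilbertType R) (rho : representation H)
    (eta : A -> H) (psi : A -> R[i]) : Prop :=
  [/\ is_cocycle rho eta,
      scalar psi &
      forall a b, psi (a * b) =
        psi a * eps b + eps a * psi b + inner (eta (star a)) (eta b)].

Definition is_generating_functional (psi : A -> R[i]) : Prop :=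
  [/\ scalar psi,
      psi 1 = 0,
      forall a, psi (star a) = (psi a)^* &
      forall a, eps a = 0 -> 0 <= psi (star a * a)].

(* The associated triple of [psi] is determined up to unitary equivalence;
   [admits_LK] refers to it by quantifying over all its representatives. *)
Definition is_associated_triple (psi : A -> R[i]) (H : hilbertType R)
    (rho : representation H) (eta : A -> H) : Prop :=
  is_schurmann_triple rho eta psi /\ dense (range eta).

Definition admits_LK (psi : A -> R[i]) : Prop :=
  forall (H : hilbertType R) (rho : representation H) (eta : A -> H),
    is_associated_triple psi rho eta ->
    exists psiG psiN : A -> R[i],
      [/\ is_generating_functional psiG,
          is_generating_functional psiN,
          is_schurmann_triple (rho_G eps rho)
            (fun a => proj (gaussian_space eps rho) (eta a)) psiG &
          is_schurmann_triple (rho_N eps rho)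
            (fun a => coproj (gaussian_space eps rho) (eta a)) psiN].

Definition property_LK : Prop :=
  forall psi, is_generating_functional psi -> admits_LK psi.

Definition is_gaussian_cocycle (H : hilbertType R) (eta : A -> H) : Prop :=
  is_cocycle (trivial_rep eps H) eta.

Definition property_GC : Prop :=
  forall (H : hilbertType R) (eta : A -> H), is_gaussian_cocycle eta ->
    exists psi, is_schurmann_triple (trivial_rep eps H) eta psi.

End Schurmann.
End Representations.

Section FreeOrthogonal.
Context (R : realType) (d : nat).
Implicit Types (A B : starAlgType R) (F : 'M[R[i]]_d).

Definition bar_mx A (a : 'M[A]_d) : 'M[A]_d := map_mx star a.
Definition adjoint_mx A (a : 'M[A]_d) : 'M[A]_d := (bar_mx a)^T.
Definition scalar_mx_in A F : 'M[A]_d := map_mx (in_alg A) F.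

Definition unitary_over A (a : 'M[A]_d) : Prop :=
  a *m adjoint_mx a = 1%:M /\ adjoint_mx a *m a = 1%:M.

Definition OF_relations F A (v : 'M[A]_d) : Prop :=
  unitary_over v /\
  v = scalar_mx_in A F *m bar_mx v *m scalar_mx_in A (invmx F).

Definition is_star_morphism A B (f : {lrmorphism A -> B}) : Prop :=
  forall a, f (star a) = star (f a).

(* Universal property of Pol(O_F^+): [v] satisfies the relations, and any [w]
   satisfying them in a *-algebra [B] is the image of [v] under a unique unital
   *-homomorphism. *)
Definition is_PolOF F A (v : 'M[A]_d) : Prop :=
  OF_relations F v /\
  forall B (w : 'M[B]_d), OF_relations F w ->
    (exists2 f : {lrmorphism A -> B}, is_star_morphism f & map_mx f v = w) /\
    (forall f g : {lrmorphism A -> B},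
       is_star_morphism f -> is_star_morphism g ->
       map_mx f v = w -> map_mx g v = w -> f =1 g).

Definition conj_mx F : 'M[R[i]]_d := map_mx Num.conj F.

(* [s] lists the eigenvalues of F^*F with their algebraic multiplicities. *)
Definition generic F : Prop :=
  exists s : seq R[i],
    char_poly ((conj_mx F)^T *m F) = \prod_(x <- s) ('X - x%:P) /\ uniq s.

End FreeOrthogonal.

(* The rest of the file proves [PolOF_exists]: the universal property [is_PolOF]
   is satisfied by a quotient of the set of *-algebra terms in the generators,
   on which the counit exists. *)

Fact conj_star_scale (R : realType) (c : R[i]) (a : R[i]^o) :
  (c *: a : R[i]^o)^* = c^* *: (a^* : R[i]^o).
Proof. by rewrite /GRing.scale /= rmorphM. Qed.
Fact conj_star_mul (R : realType) (a b : R[i]^o) :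
  ((a * b : R[i]^o)^* = b^* * a^*)%R.
Proof. by rewrite mulrC rmorphM. Qed.
HB.instance Definition _ (R : realType) :=
  hasStar.Build R R[i]^o (@conjCK R[i]) (@rmorphD _ _ (@Num.conj R[i]))
    (@conj_star_mul R) (@conj_star_scale R).

Inductive star_term (K : Type) (d : nat) : Type :=
| TGen of 'I_d & 'I_d
| TScal of K
| TAdd of star_term K d & star_term K d
| TMul of star_term K d & star_term K d
| TStar of star_term K d.
Arguments TGen {K d}.
Arguments TScal {K d}.

HB.instance Definition _ K d := gen_eqMixin (star_term K d).
HB.instance Definition _ K d := gen_choiceMixin (star_term K d).

Local Open Scope quotient_scope.

Section Existence.
Context (R : realType) (d : nat) (F : 'M[R[i]]_d).
Local Notation term := (star_term R[i] d).

Fixpoint term_eval (B : starAlgType R) (w : 'M[B]_d) (t : term) : B :=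
  match t with
  | TGen j k => w j k
  | TScal c => c%:A
  | TAdd t1 t2 => term_eval w t1 + term_eval w t2
  | TMul t1 t2 => term_eval w t1 * term_eval w t2
  | TStar t1 => star (term_eval w t1)
  end.

Definition term_equiv (t1 t2 : term) : bool :=
  `[< forall (B : starAlgType R) (w : 'M[B]_d),
        OF_relations F w -> term_eval w t1 = term_eval w t2 >].

Lemma term_equiv_refl : reflexive term_equiv.
Proof. by move=> t; apply/asboolP. Qed.

Lemma term_equiv_sym : symmetric term_equiv.
Proof.
by move=> t u; apply/asboolP/asboolP => h B w Bw; rewrite h.
Qed.

Lemma term_equiv_trans : transitive term_equiv.
Proof.
move=> u t s /asboolP h1 /asboolP h2; apply/asboolP => B w Bw.
by rewrite h1// h2.
Qed.

Canonical term_equiv_rel :=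
  EquivRel term_equiv term_equiv_refl term_equiv_sym term_equiv_trans.

Definition pol_of (_ : F \in unitmx) : Type := {eq_quot term_equiv_rel}.

Context (Fu : F \in unitmx).
Local Notation P := (pol_of Fu).
Local Notation "[ 'q' t ]" := (\pi_({eq_quot term_equiv_rel}) t : P).

HB.instance Definition _ := Choice.on P.

Definition pol_eval (B : starAlgType R) (w : 'M[B]_d) (x : P) : B :=
  term_eval w (repr (x : {eq_quot term_equiv_rel})).

Lemma pol_evalE (B : starAlgType R) (w : 'M[B]_d) t :
  OF_relations F w -> pol_eval w [q t] = term_eval w t.
Proof.
move=> Bw; rewrite /pol_eval.
have /eqquotP/asboolP := reprK (\pi_({eq_quot term_equiv_rel}) t).
by apply.
Qed.

Lemma pol_ext (x y : P) :
  (forall (B : starAlgType R) (w : 'M[B]_d), OF_relations F w -> pol_eval w x = pol_eval w y) ->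
  x = y.
Proof.
move=> h; rewrite -[x]reprK -[y]reprK; apply/eqquotP/asboolP => B w Bw.
exact: h.
Qed.

Definition pol_add (x y : P) : P := [q TAdd (repr x) (repr y)].
Definition pol_mul (x y : P) : P := [q TMul (repr x) (repr y)].
Definition pol_scale (c : R[i]) (x : P) : P := [q TMul (TScal c) (repr x)].
Definition pol_star (x : P) : P := [q TStar (repr x)].

Section Eval.
Context (B : starAlgType R) (w : 'M[B]_d) (Bw : OF_relations F w).
Lemma pol_evalD x y : pol_eval w (pol_add x y) = pol_eval w x + pol_eval w y.
Proof. by rewrite pol_evalE. Qed.
Lemma pol_evalM x y : pol_eval w (pol_mul x y) = pol_eval w x * pol_eval w y.
Proof. by rewrite pol_evalE. Qed.
Lemma pol_evalZ c x : pol_eval w (pol_scale c x) = c *: pol_eval w x.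
Proof. by rewrite pol_evalE//= -scalerAl mul1r. Qed.
Lemma pol_evalS x : pol_eval w (pol_star x) = star (pol_eval w x).
Proof. by rewrite pol_evalE. Qed.
Lemma pol_evalC c : pol_eval w [q TScal c] = c%:A.
Proof. by rewrite pol_evalE. Qed.
Definition pol_evals := (pol_evalD, pol_evalM, pol_evalZ, pol_evalS, pol_evalC).
End Eval.

Let addA : associative pol_add.
Proof. by move=> *; apply: pol_ext => B w Bw; rewrite !pol_evals// addrA. Qed.
Let addC : commutative pol_add.
Proof. by move=> *; apply: pol_ext => B w Bw; rewrite !pol_evals// addrC. Qed.
Let add0 : left_id [q TScal 0] pol_add.
Proof.
by move=> *; apply: pol_ext => B w Bw; rewrite !pol_evals// scale0r add0r.
Qed.
Let addN : left_inverse [q TScal 0] (pol_scale (-1)) pol_add.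
Proof.
by move=> *; apply: pol_ext => B w Bw;
  rewrite !pol_evals// scale0r scaleN1r addNr.
Qed.
HB.instance Definition _ := GRing.isZmodule.Build P addA addC add0 addN.

Let DE (x y : P) : x + y = pol_add x y. Proof. by []. Qed.

Let mulA : associative pol_mul.
Proof. by move=> *; apply: pol_ext => B w Bw; rewrite !pol_evals// mulrA. Qed.
Let mul1 : left_id [q TScal 1] pol_mul.
Proof.
by move=> *; apply: pol_ext => B w Bw; rewrite !pol_evals// scale1r mul1r.
Qed.
Let mulr1' : right_id [q TScal 1] pol_mul.
Proof.
by move=> *; apply: pol_ext => B w Bw; rewrite !pol_evals// scale1r mulr1.
Qed.
Let mulDl : left_distributive pol_mul +%R.
Proof.
by move=> *; apply: pol_ext => B w Bw; rewrite !DE !pol_evals// mulrDl.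
Qed.
Let mulDr : right_distributive pol_mul +%R.
Proof.
by move=> *; apply: pol_ext => B w Bw; rewrite !DE !pol_evals// mulrDr.
Qed.

Lemma OF_relations1 : OF_relations F (1%:M : 'M[R[i]^o]_d).
Proof.
have s1 : bar_mx (1%:M : 'M[R[i]^o]_d) = 1%:M.
  by apply/matrixP => i j; rewrite !mxE; exact: (rmorph_nat (@Num.conj R[i])).

have sE G : scalar_mx_in (R[i]^o : starAlgType R) G = G :> 'M[R[i]]_d.
  by apply/matrixP => i j; rewrite !mxE; exact: mulr1.
rewrite /OF_relations /unitary_over /adjoint_mx s1 trmx1 !mulmx1.
by rewrite !sE mulmxV.
Qed.

Let neq01 : [q TScal 1] != 0 :> P.
Proof.
apply/eqP => /(congr1 (pol_eval (1%:M : 'M[R[i]^o]_d))).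
have r1 := OF_relations1.
rewrite (_ : 0 = [q TScal 0])// !pol_evalC// => /eqP.
by rewrite scale0r scale1r oner_eq0.
Qed.

HB.instance Definition _ :=
  GRing.Zmodule_isNzRing.Build P mulA mul1 mulr1' mulDl mulDr neq01.

Let ME (x y : P) : x * y = pol_mul x y. Proof. by []. Qed.

Let scaleA c b x : pol_scale c (pol_scale b x) = pol_scale (c * b) x.
Proof. by apply: pol_ext => B w Bw; rewrite !pol_evals// scalerA. Qed.
Let scale1 : left_id 1 pol_scale.
Proof. by move=> *; apply: pol_ext => B w Bw; rewrite !pol_evals// scale1r. Qed.
Let scaleDr : right_distributive pol_scale +%R.
Proof.
by move=> *; apply: pol_ext => B w Bw; rewrite !DE !pol_evals// scalerDr.
Qed.
Let scaleDl x : {morph pol_scale^~ x : a b / a + b}.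
Proof.
by move=> *; apply: pol_ext => B w Bw; rewrite !DE !pol_evals// scalerDl.
Qed.
HB.instance Definition _ :=
  GRing.Zmodule_isLmodule.Build R[i] P scaleA scale1 scaleDr scaleDl.

Let ZE c (x : P) : c *: x = pol_scale c x. Proof. by []. Qed.

Let scaleAl (c : R[i]) (x y : P) : c *: (x * y) = (c *: x) * y.
Proof. by apply: pol_ext => B w Bw; rewrite !ME !ZE !pol_evals// scalerAl. Qed.
HB.instance Definition _ := GRing.Lmodule_isLalgebra.Build R[i] P scaleAl.
Let scaleAr (c : R[i]) (x y : P) : c *: (x * y) = x * (c *: y).
Proof. by apply: pol_ext => B w Bw; rewrite !ME !ZE !pol_evals// scalerAr. Qed.
HB.instance Definition _ := GRing.Lalgebra_isAlgebra.Build R[i] P scaleAr.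

Let star_K : involutive pol_star.
Proof. by move=> x; apply: pol_ext => B w Bw; rewrite !pol_evals// starK. Qed.
Let star_D (x y : P) : pol_star (x + y) = pol_star x + pol_star y.
Proof. by apply: pol_ext => B w Bw; rewrite !DE !pol_evals// starD. Qed.
Let star_M (x y : P) : pol_star (x * y) = pol_star y * pol_star x.
Proof. by apply: pol_ext => B w Bw; rewrite !ME !pol_evals// starM. Qed.
Let star_Z (c : R[i]) (x : P) : pol_star (c *: x) = c^* *: pol_star x.
Proof. by apply: pol_ext => B w Bw; rewrite !ZE !pol_evals// starZ. Qed.
HB.instance Definition _ := hasStar.Build R P star_K star_D star_M star_Z.

Definition pol_gen : 'M[P]_d := \matrix_(j, k) [q TGen j k].


Lemma pol_eval_morphism (B : starAlgType R) (w : 'M[B]_d) :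
  OF_relations F w ->
  exists2 f : {lrmorphism P -> B}, is_star_morphism f & f =1 pol_eval w.
Proof.
move=> Bw.
have lin : linear (pol_eval w).
  by move=> c x y; rewrite DE ZE !pol_evals.
have mul : monoid_morphism (pol_eval w).
  by split=> [|x y]; [rewrite (_ : 1 = [q TScal 1])// pol_evals// scale1r|
    rewrite ME pol_evals].
pose lm := GRing.isLinear.Build _ _ _ _ _ lin.
pose mm := GRing.isMonoidMorphism.Build _ _ _ mul.
pose f : {lrmorphism P -> B} :=
  HB.pack_for {lrmorphism P -> B} (pol_eval w) lm mm.
by exists f => // x; rewrite /= -pol_evalS.
Qed.

Lemma pol_gen_eval (B : starAlgType R) (w : 'M[B]_d) :
  OF_relations F w -> map_mx (pol_eval w) pol_gen = w.
Proof. by move=> Bw; apply/matrixP => j k; rewrite !mxE pol_evalE. Qed.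

Lemma pol_mx_ext (X Y : 'M[P]_d) :
  (forall (B : starAlgType R) (f : {lrmorphism P -> B}),
     is_star_morphism f -> OF_relations F (map_mx f pol_gen) ->
     map_mx f X = map_mx f Y) -> X = Y.
Proof.
move=> h; apply/matrixP => j k; apply: pol_ext => B w Bw.
have [f fs fE] := pol_eval_morphism Bw.
have gE : map_mx f pol_gen = w.
  by rewrite -[RHS](pol_gen_eval Bw); apply/matrixP => ? ?; rewrite !mxE fE.
by have := h B f fs; rewrite gE => /(_ Bw)/matrixP/(_ j k); rewrite !mxE !fE.
Qed.

Lemma map_bar_mx (A B : starAlgType R) (f : {lrmorphism A -> B})
  (a : 'M[A]_d) : is_star_morphism f ->
  map_mx f (bar_mx a) = bar_mx (map_mx f a).
Proof. by move=> fs; apply/matrixP => j k; rewrite !mxE fs. Qed.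

Lemma map_scalar_mx_in (A B : starAlgType R) (f : {lrmorphism A -> B})
  (G : 'M[R[i]]_d) : map_mx f (scalar_mx_in A G) = scalar_mx_in B G.
Proof. by apply/matrixP => j k; rewrite !mxE /= linearZ /= rmorph1. Qed.

Lemma pol_gen_relations : OF_relations F pol_gen.
Proof.
split; first split; apply: pol_mx_ext => B f fs [[r1 r2] r3];
  by rewrite /adjoint_mx ?map_mxM ?map_mx1 -?map_trmx ?map_bar_mx
    ?map_scalar_mx_in.
Qed.

Lemma pol_of_universal : is_PolOF F pol_gen.
Proof.
split; first exact: pol_gen_relations.
move=> B w Bw; split.
  have [f fs fE] := pol_eval_morphism Bw; exists f => //.
  by rewrite -[RHS](pol_gen_eval Bw); apply/matrixP => ? ?; rewrite !mxE fE.
move=> f g fs gs fw gw x.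
have gen h j k : map_mx h pol_gen = w -> h [q TGen j k] = w j k.
  by move=> <-; rewrite !mxE.
have qAdd t u : [q TAdd t u] = [q t] + [q u].
  by apply: pol_ext => B' w' Bw'; rewrite DE pol_evals// !pol_evalE.
have qMul t u : [q TMul t u] = [q t] * [q u].
  by apply: pol_ext => B' w' Bw'; rewrite ME pol_evals// !pol_evalE.
have qStar t : [q TStar t] = star [q t].
  by apply: pol_ext => B' w' Bw'; rewrite pol_evals// !pol_evalE.
have qScal c : [q TScal c] = c%:A.
  apply: pol_ext => B' w' Bw'; rewrite ZE (_ : 1 = [q TScal 1])//.
  by rewrite !pol_evals// scale1r.
rewrite -[x](reprK (x : {eq_quot term_equiv_rel})).
elim: (repr _) => [j k|c|t IHt u IHu|t IHt u IHu|t IHt].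
- by rewrite !gen.
- by rewrite qScal !linearZ /= !rmorph1.
- by rewrite qAdd !linearD /= IHt IHu.
- by rewrite qMul !rmorphM /= IHt IHu.
- by rewrite qStar fs gs IHt.
Qed.

End Existence.

Lemma PolOF_exists (R : realType) (d : nat) (F : 'M[R[i]]_d) : F \in unitmx ->
  exists (A : starAlgType R) (v : 'M[A]_d), is_PolOF F v /\
    exists eps : character A, map_mx eps v = 1%:M.
Proof.
move=> Fu; exists (pol_of Fu), (pol_gen Fu).
have univ := pol_of_universal Fu; split=> //.
have [[e es ev] _] := univ.2 R[i]^o 1%:M (OF_relations1 Fu).
by exists (@Character _ (pol_of Fu) e es).
Qed.

(* Main.v *)
From HB Require Import structures.
Require Import Defs.
From mathcomp Require Import all_boot all_order all_algebra.
From mathcomp Require Import complex ring.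
From mathcomp Require Import boolp classical_sets reals topology normedtype.

Set Implicit Arguments.
Unset Strict Implicit.
Unset Printing Implicit Defensive.

Import Order.TTheory GRing.Theory Num.Theory.
Local Open Scope complex_scope.
Local Open Scope ring_scope.

(* A Gaussian cocycle [eta] is determined by the matrix W = (eta (v_jk^* )), and
   the defining relations of O_F^+ become F W = - W^T F, up to pairing with the
   vectors of H.  Together with F (conj F) = +-1 this makes W commute with F^*F,
   so genericity lets one unitary P diagonalise all the pairings of W at once:
   P W P^* = diag (h_m) with h_m in H.  The Gram matrix G of the rows of W is
   then diag (|h_m|^2) in the same basis, and since F (in that basis) only
   links indices with h_k = - h_j, it follows that G F = F (conj G).

   A Schuermann triple with Gaussian cocycle [eta] is the same as a *-morphism
   to upper triangular 3x3 matrices [[eps, <eta (a^* )|, psi], [0, eps, |eta>],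
   [0, 0, eps]], and psi (v) = - G / 2 satisfies the relations required by
   the universal property.  For (LK), complete the Gaussian part of a
   generating functional and subtract. *)

(** * Diagonal matrices and their characteristic polynomials *)

(** Entry (i, j) of the commutation reads E_ij (s_j - s_i) = 0, which kills every off-diagonal
    entry. *)
Lemma comm_diag_mx_diag (C : idomainType) n (s : 'rV[C]_n) (E : 'M[C]_n) :
  injective (s 0) -> E *m diag_mx s = diag_mx s *m E ->
  E = diag_mx (\row_i E i i).
Proof.
move=> sI /matrixP Es; apply/matrixP => i j; rewrite !mxE.
have [->|ij] := eqVneq i j; first by rewrite mulr1n.
have := Es i j; rewrite mul_mx_diag mul_diag_mx !mxE mulrC => /eqP.
rewrite -subr_eq0 -mulrBl mulf_eq0 subr_eq0 => /orP[/eqP/sI ji|/eqP->].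
  by rewrite ji eqxx in ij.
by rewrite mulr0n.
Qed.

(** Two equal products of monic linear factors have the same factors up to order, so the diagonal
    entries are a permutation of [r]. *)
Lemma char_poly_diag_inj (C : fieldType) n (s : 'rV[C]_n) (r : seq C) :
  char_poly (diag_mx s) = \prod_(x <- r) ('X - x%:P) -> uniq r ->
  injective (s 0).
Proof.
rewrite char_poly_trig ?diag_mx_is_trig// => sr ur.
suff : uniq [seq s 0 i | i <- enum 'I_n].
  by move=> u; apply/injectiveP; rewrite /injectiveb /dinjectiveb.
rewrite (@perm_uniq _ _ r)//; apply: prod_XsubC_eq.
rewrite big_map big_enum /= -sr; apply: eq_bigr => i _.
by rewrite mxE eqxx mulr1n.
Qed.

Lemma char_poly_invmx_conj (C : comUnitRingType) n (P D : 'M[C]_n) :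
  P \in unitmx -> char_poly (invmx P *m D *m P) = char_poly D.
Proof.
move=> Pu; rewrite /char_poly /char_poly_mx.
have -> : 'X%:M - map_mx polyC (invmx P *m D *m P) =
    map_mx polyC (invmx P) *m ('X%:M - map_mx polyC D) *m map_mx polyC P.
  rewrite mulmxBr mulmxBl !map_mxM scalar_mxC; congr (_ - _).
  by rewrite -mulmxA -map_mxM mulVmx// map_mx1 mulmx1.
rewrite !det_mulmx mulrAC -det_mulmx -map_mxM mulVmx// map_mx1 det1.
by rewrite mul1r.
Qed.

(** After division by [c], a one-sided inverse of a square matrix is two-sided. *)
Lemma scalar_mul_comm (C : fieldType) n (c : C) (A B : 'M[C]_n) :
  c != 0 -> A *m B = c%:M -> B *m A = c%:M.
Proof.
move=> c0 AB; have : A *m (c^-1 *: B) = 1%:M.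
  by rewrite -scalemxAr AB scale_scalar_mx mulVf.
move/mulmx1C; rewrite -scalemxAl => /(congr1 (fun M => c *: M)).
by rewrite scalerA mulfV// scale1r scale_scalar_mx mulr1.
Qed.

(** * Matrices commuting with F^*F *)

Section GramMatrix.
Context (C : numClosedFieldType) (d : nat).
Implicit Types (F Y : 'M[C]_d).
Local Notation conjmx A := (map_mx Num.conj A).

(* The relation and its transpose move [Y] past [F] and then past [F^*]. *)
Lemma twisted_antisym_comm F Y (c : C) : c != 0 -> F *m conjmx F = c%:M ->
  F *m Y = - (Y^T *m F) ->
  Y *m ((conjmx F)^T *m F) = (conjmx F)^T *m F *m Y.
Proof.
move=> c0 Fc FY; have := congr1 trmx (scalar_mul_comm c0 Fc).
rewrite trmx_mul tr_scalar_mx => FT.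
have YF : F^T *m Y = - (Y^T *m F^T).
  have := congr1 trmx FY; rewrite trmx_mul raddfN /= trmx_mul trmxK => ->.
  by rewrite opprK.
have cF := scalar_mul_comm c0 FT.
apply: (scalerI c0); rewrite -[LHS]mul_scalar_mx -cF -mulmxA.
rewrite [F^T *m (Y *m _)]mulmxA YF mulNmx -[(Y^T *m _) *m _]mulmxA.
rewrite [F^T *m (_ *m F)]mulmxA FT mul_scalar_mx -scalemxAr -scalerN -FY.
by rewrite -scalemxAr mulmxA.
Qed.

End GramMatrix.

(** * The Gram matrix of a matrix with entries in H *)

Section HilbertGram.
Context (R : realType) (H : hilbertType R) (d : nat).
Implicit Types (F : 'M[R[i]]_d) (W : 'I_d -> 'I_d -> H).

(** Pairing with a vector turns identities between H-valued matrices into scalar ones; [inner_inj]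
    brings them back to H. *)
Definition pairing W (x : H) : 'M[R[i]]_d := \matrix_(j, k) inner x (W j k).
(** For [W j k = eta (star (v j k))], entry (j, k) collects the inner products that a Schürmann
    functional produces on entry (j, k) of v v^*. *)
Definition gram W : 'M[R[i]]_d :=
  \matrix_(j, k) \sum_l inner (W j l) (W k l).

Lemma inner_inj (a b : H) : (forall x, inner x a = inner x b) -> a = b.
Proof.
move=> ab; apply/eqP; rewrite -subr_eq0 -normr_eq0 -sqrf_eq0 -inner_norm.
by rewrite innerBr ab subrr.
Qed.

Lemma inner_sumr (I : finType) (x : H) (f : I -> H) :
  inner x (\sum_i f i) = \sum_i inner x (f i).
Proof.
exact: (big_morph (inner x) (innerDr x) (inner0r x)).
Qed.

(** The conclusion is the condition that v = F (conj v) F^-1 imposes on the corner matrix - G /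
    2. *)
Lemma gram_twisted F W (c : R[i]) : generic F -> c != 0 ->
  F *m conj_mx F = c%:M ->
  (forall x, F *m pairing W x = - ((pairing W x)^T *m F)) ->
  gram W *m F = F *m conj_mx (gram W).
Proof.
move=> [r [charF ur]] c0 Fc FW.
set K := (conj_mx F)^T *m F in charF.
pose P := spectralmx K; pose s := spectral_diag K; pose P' := (conj_mx P)^T.
have Kn : K \is normalmx.
  apply/normalmxP; rewrite /K.
  have -> : map_mx Num.conj ((conj_mx F)^T *m F)^T = (conj_mx F)^T *m F.
    rewrite trmx_mul trmxK map_mxM /=; congr (_ *m _).
      by rewrite map_trmx.
    by apply/matrixP => i j; rewrite !mxE /= conjCK.
  by [].
have PP' : P *m P' = 1%:M.
  by rewrite /P' /conj_mx map_trmx; apply/unitarymxP/spectral_unitarymx.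
have P'P : P' *m P = 1%:M := mulmx1C PP'.
have Pu : P \in unitmx by case/mulmx1_unit: PP'.
have KE : K = P' *m diag_mx s *m P.
  rewrite {1}(orthomx_spectralP Kn) -/P -/s; congr (_ *m _ *m _).
  by rewrite -[LHS]mulmx1 -PP' mulmxA mulVmx// mul1mx.
have sI : injective (s 0).
  apply: char_poly_diag_inj ur; rewrite -charF (orthomx_spectralP Kn).
  by rewrite char_poly_invmx_conj// spectral_unit.
(* The diagonal entries of P W P^* are formed in H, so that one family of vectors serves every
   [x]. *)
pose h m : H := \sum_j \sum_k (P m j * (P m k)^*) *: W j k.
have EE x : P *m pairing W x *m P' = diag_mx (\row_m inner x (h m)).
  pose E := P *m pairing W x *m P'.
  have Ec : E *m diag_mx s = diag_mx s *m E.
    have := twisted_antisym_comm c0 Fc (FW x); rewrite -/(conj_mx F) -/K KE.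
    move=> /(congr1 (fun M => P *m M *m P')).
    rewrite !mulmxA PP' mul1mx -![_ *m P *m P']mulmxA PP' mulmx1.
    by rewrite /E.
  rewrite -/E (comm_diag_mx_diag sI Ec); congr diag_mx; apply/rowP => m.
  rewrite !mxE /h inner_sumr.
  under [RHS]eq_bigr do rewrite inner_sumr.
  rewrite exchange_big; apply: eq_bigr => k _; rewrite !mxE mulr_suml.
  by apply: eq_bigr => j _; rewrite !mxE innerZr mulrAC.
pose N x : 'M[R[i]]_d := diag_mx (\row_m inner x (h m)).
have YE x : pairing W x = P' *m N x *m P.
  by rewrite /N -EE !mulmxA P'P mul1mx -mulmxA P'P mulmx1.
(* F is transformed by congruence, not by similarity, because its relation with W involves the
   transpose of W. *)
pose T := (P'^T) *m F *m P'.
have TN x : T *m N x = - (N x *m T).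
  have := FW x; rewrite YE !trmx_mul /N tr_diag_mx -/(N x).
  move=> /(congr1 (fun M => P'^T *m M *m P')).
  rewrite mulmxN mulNmx !mulmxA -trmx_mul PP' trmx1 mul1mx.
  by rewrite -[X in X = _]mulmxA PP' mulmx1 /T.
pose D : 'M[R[i]]_d := diag_mx (\row_m inner (h m) (h m)).
have TD : T *m D = D *m T.
  clearbody T; apply/matrixP => j k; rewrite mul_mx_diag mul_diag_mx !mxE.
  have [->|Tjk] := eqVneq (T j k) 0; first by rewrite mul0r mulr0.
  suff -> : h k = - h j by rewrite innerNl innerNr opprK mulrC.
  apply: inner_inj => x; have := congr1 (fun M : 'M[R[i]]_d => M j k) (TN x).
  rewrite /N mul_mx_diag mul_diag_mx !mxE mulrC -mulNr => /(mulIf Tjk) ->.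
  by rewrite innerNr.
(* This is column m of Y P' = P' N, where Y pairs W with [h m] itself, after complex conjugation. *)
have NY m j : \sum_l inner (W j l) (h m) * P m l = P m j * inner (h m) (h m).
  have : pairing W (h m) *m P' = P' *m N (h m).
    by rewrite YE -mulmxA PP' mulmx1.
  move=> /matrixP/(_ j m); rewrite mul_mx_diag !mxE => /(congr1 Num.conj).
  rewrite rmorphM /= conjCK -innerC rmorph_sum => <-; apply: eq_bigr => l _.
  by rewrite !mxE rmorphM /= conjCK -innerC.
have GE : gram W = P^T *m D *m P'^T.
  apply/matrixP => j k; rewrite mul_mx_diag !mxE.
  (* Only the second vector [W k l] is expanded in the [h m]; the sum over l is then evaluated by
     [NY]. *)
  transitivity (\sum_l \sum_m P' k m * (inner (W j l) (h m) * P m l)).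
    apply: eq_bigr => l _.
    transitivity (pairing W (W j l) k l); first by rewrite mxE.
    rewrite YE /N -mulmxA mul_diag_mx mxE; apply: eq_bigr => m _.
    by rewrite !mxE.
  rewrite exchange_big; apply: eq_bigr => m _.
  by rewrite -mulr_sumr NY !mxE mulrC.
(* Conjugation fixes D, whose entries are squared norms, and exchanges P^T with P'. *)
have GcE : conj_mx (gram W) = P' *m D *m P.
  rewrite GE /conj_mx !map_mxM; congr (_ *m _ *m _).
  - by apply/matrixP => j k; rewrite !mxE.
  - apply/matrixP => j k; rewrite !mxE rmorphMn; congr (_ *+ _).
    exact/esym/innerC.
  - by apply/matrixP => j k; rewrite !mxE /= conjCK.
(* Writing F as F P' P gives G F = P^T D T P, and exchanging D with T turns this into F P' D P. *)
rewrite GcE GE -[in LHS](mulmx1 F) -P'P !mulmxA.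
have -> : P^T *m D *m P'^T *m F *m P' = P^T *m (D *m T).
  by rewrite /T !mulmxA.
rewrite -TD /T !mulmxA -trmx_mul P'P trmx1 mul1mx.
by [].
Qed.

End HilbertGram.

(** * The star-algebra of triangular matrices over H *)

Section GaussianAlgebra.
Context (R : realType) (H : hilbertType R).

(* [(e, x, y, c)] stands for the matrix [[e, <x|, c], [0, e, |y>], [0, 0, e]]
   and [star] for the conjugate transpose in its antidiagonal.  The flag [b]
   switches the product of a bra with a ket on or off; when it is off, every
   Gaussian cocycle lifts with corner [c = 0], and the uniqueness half of the
   universal property then identifies [e], [x], [y] of a morphism to the algebra
   where it is on. *)
Definition gauss_alg (b : bool) : Type := (R[i] * H * H * R[i])%type.

HB.instance Definition _ b :=
  GRing.Zmodule.copy (gauss_alg b) (R[i] * H * H * R[i])%type.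

Section Structure.
Context (b : bool).
Local Notation B := (gauss_alg b).
Implicit Types u v : B.

Definition ga_eps u : R[i] := u.1.1.1.
Definition ga_bra u : H := u.1.1.2.
Definition ga_ket u : H := u.1.2.
Definition ga_psi u : R[i] := u.2.
Definition ga_mk e x y c : B := (e, x, y, c).

Lemma ga_ext u v : ga_eps u = ga_eps v -> ga_bra u = ga_bra v ->
  ga_ket u = ga_ket v -> ga_psi u = ga_psi v -> u = v.
Proof.
case: u => [[[e x] y] c]; case: v => [[[e' x'] y'] c'].
by rewrite /ga_eps /ga_bra /ga_ket /ga_psi /= => -> -> -> ->.
Qed.

Definition ga_one : B := ga_mk 1 0 0 0.
(** Scalars act on the bra component through their conjugates, here and in [ga_scale], because x ->
    <x| is antilinear. *)
Definition ga_mul u v : B :=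
  ga_mk (ga_eps u * ga_eps v)
    ((ga_eps u)^* *: ga_bra v + (ga_eps v)^* *: ga_bra u)
    (ga_eps u *: ga_ket v + ga_eps v *: ga_ket u)
    (ga_psi u * ga_eps v + ga_eps u * ga_psi v
       + b%:R * inner (ga_bra u) (ga_ket v)).
Definition ga_scale (k : R[i]) u : B :=
  ga_mk (k * ga_eps u) (k^* *: ga_bra u) (k *: ga_ket u) (k * ga_psi u).
Definition ga_star u : B :=
  ga_mk (ga_eps u)^* (ga_ket u) (ga_bra u) (ga_psi u)^*.

Ltac ga_split :=
  apply: ga_ext; rewrite /= /ga_mul /ga_psi /ga_eps /ga_bra /ga_ket /=.

Let mulA : associative ga_mul.
Proof.
move=> u v w; ga_split.
- exact: mulrA.
- rewrite !rmorphM !scalerDr !scalerA addrA.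
  by congr (_ + _ *: _ + _ *: _); rewrite // mulrC.
- rewrite !scalerDr !scalerA addrA.
  by congr (_ + _ *: _ + _ *: _); rewrite // mulrC.
- rewrite innerDr innerDl !innerZr !innerZl !conjCK; ring.
Qed.
Let mul1 : left_id ga_one ga_mul.
Proof.
move=> u; ga_split.
- by rewrite mul1r.
- by rewrite rmorph1 scale1r scaler0 addr0.
- by rewrite scale1r scaler0 addr0.
- by rewrite -(scale0r (0 : H)) innerZl rmorph0; ring.
Qed.
Let mulr1' : right_id ga_one ga_mul.
Proof.
move=> u; ga_split.
- by rewrite mulr1.
- by rewrite rmorph1 scale1r scaler0 add0r.
- by rewrite scale1r scaler0 add0r.
- by rewrite inner0r; ring.
Qed.
Let mulDl : left_distributive ga_mul +%R.
Proof.
move=> u v w; ga_split.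
- by rewrite mulrDl.
- by rewrite rmorphD scalerDl scalerDr addrACA.
- by rewrite scalerDl scalerDr addrACA.
- by rewrite innerDl; ring.
Qed.
Let mulDr : right_distributive ga_mul +%R.
Proof.
move=> u v w; ga_split.
- by rewrite mulrDr.
- by rewrite rmorphD scalerDl scalerDr addrACA.
- by rewrite scalerDl scalerDr addrACA.
- by rewrite innerDr; ring.
Qed.
Let neq01 : ga_one != 0.
Proof.
by apply/eqP => /(congr1 ga_eps)/eqP; rewrite /ga_eps /= oner_eq0.
Qed.

HB.instance Definition _ :=
  GRing.Zmodule_isNzRing.Build B mulA mul1 mulr1' mulDl mulDr neq01.

Let scaleA c k x : ga_scale c (ga_scale k x) = ga_scale (c * k) x.
Proof.
by ga_split; rewrite ?scalerA ?mulrA ?rmorphM.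
Qed.
Let scale1 : left_id 1 ga_scale.
Proof.
by move=> x; ga_split; rewrite ?rmorph1 ?scale1r ?mul1r.
Qed.
Let scaleDr : right_distributive ga_scale +%R.
Proof.
by move=> c x y; ga_split; rewrite ?scalerDr ?mulrDr.
Qed.
Let scaleDl x : {morph ga_scale^~ x : a c / a + c}.
Proof.
by move=> c y; ga_split; rewrite ?rmorphD ?scalerDl ?mulrDl.
Qed.
HB.instance Definition _ :=
  GRing.Zmodule_isLmodule.Build R[i] B scaleA scale1 scaleDr scaleDl.

Let scaleAl (c : R[i]) (x y : B) : c *: (x * y) = (c *: x) * y.
Proof.
ga_split.
- by rewrite mulrA.
- by rewrite rmorphM scalerDr !scalerA [c^* * _]mulrC [c^* * y.1.1.1^*]mulrC.
- by rewrite scalerDr !scalerA [c * y.1.1.1]mulrC.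
- by rewrite innerZl conjCK; ring.
Qed.
HB.instance Definition _ := GRing.Lmodule_isLalgebra.Build R[i] B scaleAl.
Let scaleAr (c : R[i]) (x y : B) : c *: (x * y) = x * (c *: y).
Proof.
ga_split.
- by rewrite mulrCA.
- by rewrite rmorphM scalerDr !scalerA [c^* * x.1.1.1^*]mulrC.
- by rewrite scalerDr !scalerA [c * x.1.1.1]mulrC.
- by rewrite innerZr; ring.
Qed.
HB.instance Definition _ := GRing.Lalgebra_isAlgebra.Build R[i] B scaleAr.

Let star_K : involutive ga_star.
Proof.
by move=> u; ga_split; rewrite ?conjCK.
Qed.
Let star_D (x y : B) : ga_star (x + y) = ga_star x + ga_star y.
Proof.
by ga_split; rewrite ?rmorphD.
Qed.
Let star_M (x y : B) : ga_star (x * y) = ga_star y * ga_star x.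
Proof.
ga_split.
- by rewrite rmorphM mulrC.
- by rewrite conjCK conjCK addrC.
- by rewrite addrC.
- by rewrite !rmorphD !rmorphM rmorph_nat /= -innerC; ring.
Qed.
Let star_Z (c : R[i]) (x : B) : ga_star (c *: x) = c^* *: ga_star x.
Proof.
by ga_split; rewrite ?rmorphM ?conjCK.
Qed.
HB.instance Definition _ := hasStar.Build R B star_K star_D star_M star_Z.

End Structure.
End GaussianAlgebra.

(** * From (GC) to (LK) *)

Section LevyKhintchine.
Context (R : realType) (A : starAlgType R) (eps : character A).

(** The difference of the two candidates lies in S and is orthogonal to S. As [proj] is obtained by
    choice, this uniqueness is the way to compute it. *)
Lemma proj_eq (H : hilbertType R) (S : closed_subspace H) (x : H)
  (y : carrier S) : Defs.orthogonal S (x - val y) -> proj S x = y.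
Proof.
move=> xy; apply: val_inj; apply/eqP; rewrite -subr_eq0.
set z := _ - _.
have Sz : (S : set H) z.
  rewrite /z addrC -scaleN1r; apply: subspaceP; exact: set_mem (valP _).
have := orthogonal_P (-1) (@proj_orthogonal _ _ S x) xy Sz.
rewrite scaleN1r opprB addrA subrK -/z inner_norm => /eqP.
by rewrite expf_eq0 /= normr_eq0.
Qed.

Lemma proj_linear (H : hilbertType R) (S : closed_subspace H) :
  linear (proj S).
Proof.
move=> c x y; apply: proj_eq.
rewrite (_ : val _ = c *: val (proj S x) + val (proj S y))// opprD addrACA.
rewrite -scalerBr.
by apply: orthogonal_P; exact: proj_orthogonal.
Qed.

Lemma coproj_linear (H : hilbertType R) (S : closed_subspace H) :
  linear (coproj S).
Proof.
move=> c x y; apply: val_inj.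
change (c *: x + y - val (proj S (c *: x + y)) =
  c *: (x - val (proj S x)) + (y - val (proj S y))).
rewrite proj_linear scalerBr addrACA -opprD.
by congr (_ - _).
Qed.

Lemma inner_proj_coproj (H : hilbertType R) (S : closed_subspace H) (x y : H) :
  inner x y = inner (proj S x) (proj S y) + inner (coproj S x) (coproj S y).
Proof.
have Sp z : (S : set H) (val (proj S z)) by exact: set_mem (valP _).
change (inner x y = inner (val (proj S x)) (val (proj S y)) +
  inner (x - val (proj S x)) (y - val (proj S y))).
have h1 := @proj_orthogonal _ _ S y _ (Sp x).
have h2 := @proj_orthogonal _ _ S x _ (Sp y).
rewrite innerBl h1 subr0 -[X in X + _]conjCK -innerC.
have -> : inner (val (proj S y)) (val (proj S x)) = inner (val (proj S y)) x.
  by apply/eqP; rewrite eq_sym -subr_eq0 -innerBr h2.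
by rewrite -innerC innerBr addrC subrK.
Qed.

(** The Gaussian subspace and its orthocomplement are both invariant under [rho], so the projection
    commutes with [rho a]. *)
Lemma proj_gaussian_rep (H : hilbertType R) (rho : representation A H) a x :
  proj (gaussian_space eps rho) (rho a x) =
  rho_G eps rho a (proj (gaussian_space eps rho) x).
Proof.
apply: proj_eq; rewrite /= -(scaleN1r (rho a _)) addrC -rep_op_linear.
rewrite scaleN1r addrC; apply: gaussian_compl_stable.
exact: proj_orthogonal.
Qed.

Lemma coproj_gaussian_rep (H : hilbertType R) (rho : representation A H) a x :
  coproj (gaussian_space eps rho) (rho a x) =
  rho_N eps rho a (coproj (gaussian_space eps rho) x).
Proof.
apply: val_inj; rewrite /= proj_gaussian_rep /=.
by rewrite -(scaleN1r (rho a _)) addrC -rep_op_linear scaleN1r addrC.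
Qed.

Lemma rho_G_trivial (H : hilbertType R) (rho : representation A H) a x :
  rho_G eps rho a x = trivial_rep eps (carrier (gaussian_space eps rho)) a x.
Proof.
by apply: val_inj; exact: (set_mem (valP x)).
Qed.

Lemma cocycle_one (H : hilbertType R) (rho : representation A H) eta :
  is_cocycle eps rho eta -> eta 1 = 0.
Proof.
move=> [_ /(_ 1 1)]; rewrite mulr1 rmorph1 rep1 scale1r => /esym/eqP.
by rewrite -subr_eq0 addrK => /eqP.
Qed.

Lemma star_one : star (1 : A) = 1.
Proof. by rewrite -[LHS]mulr1 -[X in _ * X]starK -starM mulr1 starK. Qed.

(** On [star a * a] with [eps a = 0] the Schürmann identity leaves only the squared norm of [eta a];
    at (1, 1) it gives [psi 1 = 0], since [eta 1 = 0]. *)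
Lemma schurmann_generating (H : hilbertType R) (rho : representation A H)
    eta psi :
  is_schurmann_triple eps rho eta psi ->
  (forall a, psi (star a) = (psi a)^*) -> is_generating_functional eps psi.
Proof.
move=> [etaC lpsi psiM] psiS; split=> //.
  have := psiM 1 1; rewrite star_one (cocycle_one etaC) inner0r mulr1 rmorph1.
  rewrite mulr1 mul1r addr0 => /esym/eqP.
  by rewrite -subr_eq0 addrK => /eqP.
move=> a ea; rewrite psiM ea character_star ea conjC0 mulr0 mul0r !add0r.
by rewrite starK inner_norm exprn_ge0.
Qed.

(** The functional sending [a] to the conjugate of [psi (star a)] completes the same cocycle, and so
    does its average with [psi]. *)
Lemma schurmann_hermitian (H : hilbertType R) (rho : representation A H)
    eta psi :
  is_schurmann_triple eps rho eta psi ->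
  exists2 psi', is_schurmann_triple eps rho eta psi' &
    forall a, psi' (star a) = (psi' a)^*.
Proof.
move=> [etaC lpsi psiM]; pose psi' a := (psi a + (psi (star a))^*) / 2.
exists psi'.
  split=> //.
    move=> c a b; rewrite /psi' starD starZ !lpsi rmorphD rmorphM /= conjCK.
    by field.
  move=> a b; rewrite /psi' starM !psiM !character_star !rmorphD !rmorphM /=.
  by rewrite !conjCK starK -innerC; field.
move=> a; rewrite /psi' starK rmorphM rmorphD /= conjCK fmorphV rmorph_nat.
by rewrite addrC.
Qed.

Lemma GC_LK : property_GC eps -> property_LK eps.
Proof.
move=> GC psi [lpsi psi1 psiS psi_ge0] H rho eta [[[leta etaM] _ psiM] _].
set S := gaussian_space eps rho.
pose etaG a := proj S (eta a).
have etaGC : is_cocycle eps (rho_G eps rho) etaG.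
  split=> [c a b|a b]; first by rewrite /etaG leta proj_linear.
  rewrite /etaG etaM addrC proj_linear proj_gaussian_rep addrC.
  by [].
have etaGg : is_gaussian_cocycle eps etaG.
  split; first exact: etaGC.1.
  by move=> a b; rewrite etaGC.2 rho_G_trivial.
(* (GC) gives no hermitian condition, which a generating functional must satisfy, so its functional
   is symmetrised. *)
have [psi0 /schurmann_hermitian[psiG [_ lG GM] GS]] := GC _ _ etaGg.
have tG : is_schurmann_triple eps (rho_G eps rho) etaG psiG by split.
(* Inner products of values of [eta] split along S and its orthocomplement, so the difference keeps
   exactly those of [coproj]. *)
pose psiN a := psi a - psiG a.
have tN :
    is_schurmann_triple eps (rho_N eps rho) (fun a => coproj S (eta a)) psiN.
  split.
  - split=> [c a b|a b]; first by rewrite leta coproj_linear.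
    by rewrite etaM addrC coproj_linear coproj_gaussian_rep addrC.
  - by move=> c a b; rewrite /psiN lpsi lG; ring.
  - move=> a b; rewrite /psiN psiM GM (inner_proj_coproj S).
    by rewrite /etaG; ring.
exists psiG, psiN; split=> //.
- exact: schurmann_generating tG GS.
- apply: schurmann_generating tN _ => a.
  by rewrite /psiN psiS GS rmorphB.
Qed.

End LevyKhintchine.

Lemma sum_delta (C : nzRingType) (V : lmodType C) (I : finType) (j : I)
  (f : I -> V) : \sum_i (j == i)%:R *: f i = f j.
Proof.
rewrite (bigD1 j)//= eqxx scale1r big1 ?addr0// => i ij.
by rewrite eq_sym (negbTE ij) scale0r.
Qed.

Lemma sum_delta_mul (C : nzRingType) (I : finType) (j : I) (f : I -> C) :
  \sum_i (j == i)%:R * f i = f j.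
Proof. exact: (@sum_delta C C^o). Qed.

(** * Gaussian cocycles as star-morphisms *)

Section GaussianCompletion.
Context (R : realType) (A : starAlgType R) (eps : character A).
Context (H : hilbertType R) (eta : A -> H).

Section Maps.
Context (b : bool).
Local Notation B := (gauss_alg H b).

Lemma ga_psi_linear : scalar (@ga_psi R H b : B -> R[i]).
Proof. by []. Qed.
HB.instance Definition _ :=
  GRing.isLinear.Build R[i] B R[i] _ (@ga_psi R H b) ga_psi_linear.

Definition ga_forget (u : B) : gauss_alg H false :=
  ga_mk false (ga_eps u) (ga_bra u) (ga_ket u) 0.

(** Setting the corner to 0 is multiplicative because in the target no bra-ket product enters the
    corner. *)
Lemma ga_forget_morphism :
  exists2 f : {lrmorphism B -> gauss_alg H false},
    is_star_morphism f & f =1 ga_forget.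
Proof.
have lin : linear ga_forget.
  move=> c x y; apply: ga_ext => //.
  by rewrite /ga_psi /= mulr0 addr0.
have mul : monoid_morphism ga_forget.
  split=> [|x y]; apply: ga_ext => //.
  by rewrite /ga_psi /= mulr0 mul0r mul0r !addr0.
pose lm := GRing.isLinear.Build _ _ _ _ _ lin.
pose mm := GRing.isMonoidMorphism.Build _ _ _ mul.
exists (HB.pack_for {lrmorphism B -> gauss_alg H false} ga_forget lm mm) => //.
by move=> x; apply: ga_ext => //; rewrite /ga_psi /= rmorph0.
Qed.

End Maps.

Definition cocycle_lift (a : A) : gauss_alg H false :=
  ga_mk false (eps a) (eta (star a)) (eta a) 0.

Context (etaG : is_gaussian_cocycle eps eta).

Lemma gaussian_cocycleM a a' : eta (a * a') = eps a *: eta a' + eps a' *: eta a.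
Proof. exact: etaG.2. Qed.

(** The Gaussian cocycle identity at (a, a') and at the adjoints in reverse order is
    multiplicativity in the ket and bra components. *)
Lemma cocycle_lift_morphism :
  exists2 f : {lrmorphism A -> gauss_alg H false},
    is_star_morphism f & f =1 cocycle_lift.
Proof.
have lin : linear cocycle_lift.
  move=> c x y; apply: ga_ext; rewrite /ga_eps /ga_bra /ga_ket /ga_psi /=.
  - by rewrite linearP.
  - by rewrite starD starZ etaG.1.
  - by rewrite etaG.1.
  - by rewrite mulr0 addr0.
have mul : monoid_morphism cocycle_lift.
  split=> [|x y]; apply: ga_ext; rewrite /ga_eps /ga_bra /ga_ket /ga_psi /=.
  - exact: rmorph1.
  - by rewrite star_one (cocycle_one etaG).
  - exact: cocycle_one etaG.
  - by [].
  - exact: rmorphM.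
  - by rewrite starM gaussian_cocycleM !character_star addrC.
  - exact: gaussian_cocycleM.
  - by rewrite mulr0 mul0r mul0r !addr0.
pose lm := GRing.isLinear.Build _ _ _ _ _ lin.
pose mm := GRing.isMonoidMorphism.Build _ _ _ mul.
exists (HB.pack_for {lrmorphism A -> gauss_alg H false} cocycle_lift lm mm) =>
  //.
move=> x; apply: ga_ext; rewrite /ga_eps /ga_bra /ga_ket /ga_psi /=.
- exact: character_star.
- by rewrite starK.
- by [].
- by rewrite rmorph0.
Qed.

End GaussianCompletion.

(** The outer factors have scalar entries, so linearity of [f] suffices; this covers <x, eta> and
    the corner functional, which are not multiplicative. *)
Lemma map_mx_scalar_mul (R : realType) (A : starAlgType R) (d : nat)
  (f : {scalar A}) (M N : 'M[R[i]]_d) (a : 'M[A]_d) :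
  map_mx f (scalar_mx_in A M *m a *m scalar_mx_in A N) =
  M *m map_mx f a *m N.
Proof.
apply/matrixP => j k; rewrite !mxE linear_sum; apply: eq_bigr => l _.
rewrite !mxE -scalerAr mulr1 linearZ /= mulrC linear_sum; congr (_ * _).
by apply: eq_bigr => m _; rewrite !mxE -scalerAl mul1r linearZ.
Qed.

(** * (GC) from the universal property *)

Section UniversalProperty.
Context (R : realType) (d : nat) (F : 'M[R[i]]_d) (A : starAlgType R).
Context (v : 'M[A]_d) (eps : character A).

Lemma map_mx_OF_relations (B : starAlgType R) (f : {lrmorphism A -> B}) :
  is_star_morphism f -> OF_relations F v -> OF_relations F (map_mx f v).
Proof.
move=> fs [[r1 r2] r3]; split; first split.
- by move/(congr1 (map_mx f)): r1;
    rewrite /adjoint_mx map_mxM map_mx1 -map_trmx map_bar_mx.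
- by move/(congr1 (map_mx f)): r2;
    rewrite /adjoint_mx map_mxM map_mx1 -map_trmx map_bar_mx.
- by rewrite {1}r3 !map_mxM !map_scalar_mx_in map_bar_mx.
Qed.

Lemma OF_property_GC (c : R[i]) : F \in unitmx -> generic F -> c != 0 ->
  F *m conj_mx F = c%:M -> is_PolOF F v -> map_mx eps v = 1%:M ->
  property_GC eps.
Proof.
move=> Fu Fgen c0 Fc [[[vv vv'] vF] univ] ev H eta etaG.
have evE j k : eps (v j k) = (j == k)%:R.
  by have /matrixP/(_ j k) := ev; rewrite !mxE.
pose W j k := eta (star (v j k)); pose V j k := eta (v j k).
have eta_lin := etaG.1.
pose leta := GRing.isLinear.Build _ _ _ _ _ eta_lin.
pose etal : {linear A -> H} := HB.pack_for {linear A -> H} eta leta.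
have etalE a : etal a = eta a by [].
(* Apply [eta] to v v^* = 1; the Kronecker deltas coming from [eps] leave [W k j + V j k = 0]. *)
have VW j k : V j k = - W k j.
  apply/eqP; rewrite -addr_eq0; apply/eqP.
  have /matrixP/(_ j k)/(congr1 etal) := vv.
  rewrite !mxE linear_sum.
  rewrite (_ : etal (_ *+ _) = 0); last first.
    by case: (j == k); rewrite ?mulr0n ?linear0 //= (cocycle_one etaG).
  move=> <-; under eq_bigr => l _ do
    rewrite !mxE etalE (gaussian_cocycleM etaG) character_star !evE rmorph_nat.
  by rewrite big_split /= !sum_delta addrC.
(* Apply <x, eta> to v F = F (conj v): by [VW], v goes to the negative transpose of the pairing of
   W, and conj v to that pairing. *)
have FW x : F *m pairing W x = - ((pairing W x)^T *m F).
  have lin : scalar (fun a => inner x (eta a)).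
    by move=> k a b; rewrite eta_lin innerDr innerZr.
  pose lf := GRing.isLinear.Build _ _ _ _ _ lin.
  pose f : {scalar A} := HB.pack_for {scalar A} (fun a => inner x (eta a)) lf.
  have fV : map_mx f v = - (pairing W x)^T.
    by apply/matrixP => j k; rewrite !mxE /= -/(V j k) VW innerNr.
  have fW : map_mx f (bar_mx v) = pairing W x.
    by apply/matrixP => j k; rewrite !mxE.
  rewrite -mulNmx -fV {1}vF map_mx_scalar_mul fW -!mulmxA mulVmx//.
  by rewrite mulmx1.
pose psi1 : {scalar gauss_alg H true} := @ga_psi R H true.
(* Unitarity asks the corner p to satisfy p_jk + conj p_kj + G_jk = 0; as G is hermitian, - G / 2 is
   its hermitian solution. *)
pose G := gram W; pose w : 'M[gauss_alg H true]_d :=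
  \matrix_(j, k) ga_mk true (eps (v j k)) (W j k) (V j k) (- (G j k / 2)).
have [theta theta_star thetaE] := cocycle_lift_morphism etaG.
have [pi pi_star piE] := ga_forget_morphism H true.
have piw : map_mx pi w = map_mx theta v.
  by apply/matrixP => j k; rewrite !mxE piE thetaE.
(* Each relation for [w] splits in two: its image under [pi] holds because [pi] maps [w] to the
   image of [v] under [theta], so only the corner needs computing. *)
have wE (M N : 'M[gauss_alg H true]_d) :
    map_mx pi M = map_mx pi N -> map_mx psi1 M = map_mx psi1 N -> M = N.
  move=> /matrixP pMN /matrixP sMN; apply/matrixP => j k.
  move: (pMN j k) (sMN j k); rewrite !mxE !piE => pjk sjk.
  apply: ga_ext => //; [exact: congr1 (@ga_eps R H false) _ _ pjk
    |exact: congr1 (@ga_bra R H false) _ _ pjk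
    |exact: congr1 (@ga_ket R H false) _ _ pjk].
have [[t1 t2] t3] : OF_relations F (map_mx theta v).
  exact: map_mx_OF_relations.
have GC j k : (G k j)^* = G j k.
  rewrite !mxE rmorph_sum; apply: eq_bigr => l _.
  by rewrite /= -innerC.
have psiM (a b : gauss_alg H true) : psi1 (a * b) =
    ga_eps b * psi1 a + ga_eps a * psi1 b + inner (ga_bra a) (ga_ket b).
  rewrite [ga_eps b * _]mulrC -[inner _ _]mul1r.
  by [].
have psi1_1 : map_mx psi1 (1%:M : 'M_d) = 0.
  apply/matrixP => j k; rewrite !mxE.
  by case: (j == k); rewrite ?mulr1n ?mulr0n ?linear0.
have w_eps j k : ga_eps (w j k) = (j == k)%:R.
  by rewrite mxE; exact: evE.
have w_bra j k : ga_bra (w j k) = W j k by rewrite mxE.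
have w_ket j k : ga_ket (w j k) = V j k by rewrite mxE.
have w_psi j k : psi1 (w j k) = - (G j k / 2) by rewrite mxE.
have starE (u : gauss_alg H true) : [/\ ga_eps (star u) = (ga_eps u)^*,
  ga_bra (star u) = ga_ket u, ga_ket (star u) = ga_bra u &
  psi1 (star u) = (psi1 u)^*] by [].
have adjE j k : adjoint_mx w j k = star (w k j) by rewrite mxE mxE.
have halves j k : - (G j k / 2) + (- (G k j / 2))^* + G j k = 0.
  by rewrite rmorphN rmorphM fmorphV rmorph_nat /= GC; field.
have w1 : w *m adjoint_mx w = 1%:M.
  apply: wE.
    by rewrite /adjoint_mx map_mxM map_mx1 -map_trmx map_bar_mx// piw.
  rewrite psi1_1; apply/matrixP => j k; rewrite !mxE linear_sum.
  under eq_bigr => l _.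
    rewrite adjE psiM; have [-> _ -> ->] := starE (w k l).
    rewrite !w_eps !w_bra !w_psi rmorph_nat; over.
  rewrite !big_split /= !sum_delta_mul.
  have -> : \sum_l inner (W j l) (W k l) = G j k by rewrite mxE.
  exact: halves.
(* The corner now involves <V_lj, V_lk>; by [VW] the signs cancel and the same G appears. *)
have w2 : adjoint_mx w *m w = 1%:M.
  apply: wE.
    by rewrite /adjoint_mx map_mxM map_mx1 -map_trmx map_bar_mx// piw.
  rewrite psi1_1; apply/matrixP => j k; rewrite !mxE linear_sum.
  under eq_bigr => l _.
    rewrite adjE psiM; have [-> -> _ ->] := starE (w l j).
    rewrite !w_eps !w_ket !w_psi rmorph_nat !VW innerNl innerNr opprK.
    rewrite (eq_sym l k) (eq_sym l j); over.
  rewrite !big_split /= !sum_delta_mul.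
  have -> : \sum_l inner (W j l) (W k l) = G j k by rewrite mxE.
  by rewrite [X in X + _]addrC; exact: halves.
have w3 : w = scalar_mx_in _ F *m bar_mx w *m scalar_mx_in _ (invmx F).
  apply: wE.
    by rewrite {1}piw !map_mxM !map_scalar_mx_in map_bar_mx// piw.
  (* The corner equation is G = F (conj G) F^-1 up to the factor -1/2, that is [gram_twisted]. *)
  rewrite map_mx_scalar_mul.
  have -> : map_mx psi1 (bar_mx w) = - 2^-1 *: conj_mx G.
    apply/matrixP => j k; rewrite 2!mxE; have [_ _ _ ->] := starE (w j k).
    rewrite w_psi !mxE /= rmorphN rmorphM fmorphV rmorph_nat /=.
    by rewrite mulrC mulNr.
  have -> : map_mx psi1 w = - 2^-1 *: G.
    by apply/matrixP => j k; rewrite mxE w_psi [RHS]mxE mulNr mulrC.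
  rewrite -scalemxAr -scalemxAl -(gram_twisted Fgen c0 Fc FW).
  by rewrite -mulmxA mulmxV// mulmx1.
have [[f f_star fv] _] := univ _ w (conj (conj w1 w2) w3).
have fE a : pi (f a) = theta a.
  have [_ uniq_mor] := univ _ _ (conj (conj t1 t2) t3).
  apply: (uniq_mor (pi \o f) theta) => //.
  - by move=> x; rewrite /= f_star pi_star.
  - by rewrite map_mx_comp fv.
have {fE} fE a : [/\ ga_eps (f a) = eps a, ga_bra (f a) = eta (star a) &
    ga_ket (f a) = eta a].
  by have := fE a; rewrite piE thetaE; case.
(* The corner of the product rule, read on [f a * f b], is the Schürmann identity. *)
exists (psi1 \o f); split=> //.
- by move=> k a b; rewrite -[LHS]/(psi1 (f (k *: a + b))) linearP.
- move=> a b; rewrite /= rmorphM psiM; have [-> -> _] := fE a.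
  by have [-> _ ->] := fE b; rewrite mulrC.
Qed.

End UniversalProperty.

Theorem theorem2p2 (R : realType) (d : nat) (F : 'M[R[i]]_d)
    (A : starAlgType R) (v : 'M[A]_d) (eps : character A) :
  F \in unitmx ->
  generic F ->
  F *m conj_mx F = 1%:M \/ F *m conj_mx F = - 1%:M ->
  is_PolOF F v ->
  map_mx eps v = 1%:M ->
  property_GC eps /\ property_LK eps.
Proof.
move=> Fu Fgen Fc univ ev.
(* Both signs are treated at once as a nonzero scalar. *)
have [c c0 {}Fc] : exists2 c : R[i], c != 0 & F *m conj_mx F = c%:M.
  case: Fc => ->; first by exists 1; rewrite ?oner_eq0.
  by exists (-1); rewrite ?oppr_eq0 ?oner_eq0// raddfN.
have GC := OF_property_GC Fu Fgen c0 Fc univ ev.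
by split=> //; exact: GC_LK.
Qed.
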